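(* Let $p>3$ be a prime and $e\ge 2$ an integer. For every $a\in(p)$ and all $b,x_0\in\mathbb{Z}_{p^e}$, the IPRNG given by $(a,b,x_0)$ has period $L(x_0;a,b)=1$. Consequently the number of IPRNGs $(a,b,x_0)$ with $a\in(p)$, $b,x_0\in\mathbb{Z}_{p^e}$ of period $1$ is $p^{3e-1}$ (and no other period occurs).
   Context: $\mathbb{Z}_{p^e}=\mathbb{Z}/p^e\mathbb{Z}$, with group of units $\mathbb{Z}_{p^e}^{\times}$; $(p)=p\,\mathbb{Z}_{p^e}$ is the set of non-units. An inversive pseudorandom number generator (IPRNG) is a triple $(a,b,x_0)\in\mathbb{Z}_{p^e}^3$, with map $\phi:\mathbb{Z}_{p^e}\to\mathbb{Z}_{p^e}$, $\phi(x)=ax^{-1}+b$ if $x\in\mathbb{Z}_{p^e}^{\times}$ and $\phi(x)=b$ if $x\in(p)$, and sequence $x_{n+1}=\phi(x_n)$, $n\ge 0$, started at $x_0$. Its period $L(x_0;a,b)$ is the least positive integer $L$ such that, for some $n_0\ge 0$, $x_{n+L}=x_n$ for all $n\ge n_0$ (the sequence need only be ultimately periodic). The number of IPRNGs of a given period is the number of such triples. *)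

(* Defs.v *)
From HB Require Import structures.
From mathcomp Require Import all_boot all_order all_algebra.
From mathcomp Require Import boolp.

Set Implicit Arguments.
Unset Strict Implicit.
Unset Printing Implicit Defensive.

Import GRing.Theory.
Local Open Scope ring_scope.

Definition ult_period (T : Type) (u : nat -> T) (L : nat) : Prop :=
  (0 < L)%N /\ exists n0 : nat, forall n : nat, (n0 <= n)%N -> u (n + L)%N = u n.

Definition principal_ideal (R : finComUnitRingType) (r : R) : {set R} :=
  [set r * y | y : R].

Section IPRNG.

Variable R : finComUnitRingType.
Implicit Types a b x : R.

(* The unit test is needed: in MathComp [x^-1 = x] when [x] is not a unit. *)
Definition iprng_map a b x : R :=
  if x \is a GRing.unit then a * x^-1 + b else b.

Definition iprng_seq a b x0 (n : nat) : R := iter n (iprng_map a b) x0.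

Lemma ex_ult_period a b x0 :
  exists L : nat, `[< ult_period (iprng_seq a b x0) L >].
Proof.
have /trajectP[i lt_i eq_i] := looping_order (iprng_map a b) x0.
set m := fingraph.order _ _ in lt_i eq_i.
exists (m - i)%N; apply/asboolP; split; first by rewrite subn_gt0.
exists i => n le_in; rewrite /iprng_seq -(subnK le_in) -addnA subnKC 1?ltnW //.
by rewrite !iterD eq_i.
Qed.

Definition iprng_period a b x0 : nat := ex_minn (ex_ult_period a b x0).

(* A triple [(a, b, x0)] is encoded as [t = ((a, b), x0)]. *)
Definition iprngs_of_period (A : {set R}) (L : nat) : {set R * R * R} :=
  [set t | (t.1.1 \in A) && (iprng_period t.1.1 t.1.2 t.2 == L)].

End IPRNG.

(* Main.v *)
(** When [a] is nilpotent, adding a multiple of [a] does not change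
    invertibility, so every value of [x |-> a x^-1 + b] is a unit exactly when
    [b] is. If [b] is not a unit, the sequence is [b] from its second iterate
    on. If [b] is a unit, then [phi y - phi x = a (x - y) / (x y)] on units, so
    consecutive differences are divisible by growing powers of [a] and
    eventually vanish. *)
Require Import Defs.
From HB Require Import structures.
From mathcomp Require Import all_boot all_order all_algebra.
From mathcomp Require Import all_fingroup cyclic.
From mathcomp Require Import boolp.
Import GRing.Theory.
Local Open Scope ring_scope.

(** The geometric sum of the powers of [z] below [k] is an inverse, as its product with [1 - z] is
    [1 - z ^+ k]. *)
Lemma unitr_1Bnilp (R : comUnitRingType) (z : R) (k : nat) :
  z ^+ k = 0 -> 1 - z \is a GRing.unit.
Proof.
move=> zk0; have := subrX1 z k; rewrite zk0 sub0r -(opprB 1 z) mulNr.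
by move/oppr_inj => h; move: (unitr1 R); rewrite [X in X \is a _]h unitrM; case/andP.
Qed.

Lemma unitrD_nilp (R : comUnitRingType) (z b : R) (k : nat) :
  z ^+ k = 0 -> (z + b \is a GRing.unit) = (b \is a GRing.unit).
Proof.
have imp (w c : R) : w ^+ k = 0 -> c \is a GRing.unit ->
    w + c \is a GRing.unit.
  move=> wk0 cu; have -> : w + c = c * (1 - - (w / c)).
    by rewrite opprK mulrDr mulr1 mulrCA divrr // mulr1 addrC.
  rewrite unitrM cu /=; apply: (@unitr_1Bnilp _ _ k).
  by rewrite exprNn exprMn wk0 mul0r mulr0.
move=> zk0; apply/idP/idP => [zbu|]; last exact: imp.
(* The converse is the same implication for [- z], since [b = - z + (z + b)]. *)
rewrite -(addKr z b); apply: imp => //.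
by rewrite exprNn zk0 mulr0.
Qed.

Lemma iprng_period1 (R : finComUnitRingType) (a b x0 : R) (m : nat) :
    iprng_map a b (iprng_seq a b x0 m) = iprng_seq a b x0 m ->
  iprng_period a b x0 = 1%N.
Proof.
move=> fixm; rewrite /iprng_period; case: ex_minnP => L /asboolP[L0 _] minL.
apply/eqP; rewrite eqn_leq L0 andbT; apply: minL; apply/asboolP; split=> //.
exists m => n /subnK <-; rewrite addn1 /iprng_seq iterS.
rewrite (iterD (n - m)) -/(iprng_seq a b x0 m).
by rewrite -iterS iterSr fixm.
Qed.

Section NilpotentMultiplier.

Variables (R : finComUnitRingType) (a b : R) (k : nat).
Hypothesis ak0 : a ^+ k = 0.

Lemma iprng_map_unit x :
  (iprng_map a b x \is a GRing.unit) = (b \is a GRing.unit).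
Proof.
rewrite /iprng_map; case: ifP => // _.
by apply: (@unitrD_nilp _ _ _ k); rewrite exprMn ak0 mul0r.
Qed.

Lemma iprng_mapB x y : x \is a GRing.unit -> y \is a GRing.unit ->
  iprng_map a b y - iprng_map a b x = a * (y - x) * - (x^-1 * y^-1).
Proof.
move=> xu yu; rewrite /iprng_map xu yu opprD addrACA subrr addr0 -mulrBr.
rewrite -mulrA; congr (_ * _); rewrite mulrN -mulNr opprB mulrBl mulVKr //.
by rewrite mulrCA divrr // mulr1.
Qed.

(** By [iprng_mapB], each iteration gains a factor [a]. Indices start at 1 because [x0] may be a
    non-unit, while all later terms are units. *)
Lemma iprng_seqB x0 n : b \is a GRing.unit ->
  exists c, iprng_seq a b x0 n.+2 - iprng_seq a b x0 n.+1 = a ^+ n * c.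
Proof.
move=> bu; elim: n => [|n [c IHn]].
  by eexists; rewrite expr0 mul1r.
rewrite {1}/iprng_seq iterS [X in _ - X]iterS iprng_mapB /= ?iprng_map_unit //.
by eexists; move: IHn; rewrite /iprng_seq /= => ->; rewrite mulrA -exprS -mulrA.
Qed.

Lemma nilpotent_iprng_period x0 : iprng_period a b x0 = 1%N.
Proof.
have [bu|bnu] := boolP (b \is a GRing.unit).
  apply: (@iprng_period1 _ _ _ _ k.+1); apply/eqP; rewrite -subr_eq0.
  by have [c] := iprng_seqB x0 k bu; rewrite ak0 mul0r => /eqP.
(* The inner value is a non-unit, so the outer map takes its default value [b]. *)
have mapb x : iprng_map a b (iprng_map a b x) = b.
  by rewrite {1}/iprng_map iprng_map_unit (negbTE bnu).
by apply: (@iprng_period1 _ _ _ _ 2); rewrite /= !mapb.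
Qed.

End NilpotentMultiplier.

(** Every residue is a natural multiple of 1, so the ideal is the additive cyclic group generated by
    [d], whose order is that of 1 divided by [d]. *)
Lemma card_principal_ideal_Zp (n d : nat) : (1 < n)%N -> (d %| n)%N ->
  #|principal_ideal (d%:R : 'Z_n)| = (n %/ d)%N.
Proof.
move=> n1 dn.
have -> : principal_ideal (d%:R : 'Z_n) = <[d%:R : 'Z_n]>%g.
  apply/setP => x; apply/imsetP/cycleP => [[y _ ->]|[i ->]].
    by exists y; rewrite FinRing.zmodXgE -[X in _ * X = _]natr_Zp mulr_natr.
  by exists i%:R => //; rewrite FinRing.zmodXgE mulr_natr.
by rewrite -orderE -FinRing.zmodXgE orderXdiv order_Zp1 Zp_cast.
Qed.

Theorem theorem1 (p e : nat) (p_prime : prime p) (p_gt3 : (3 < p)%N)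
    (e_ge2 : (2 <= e)%N) :
  (forall a b x0 : 'Z_(p ^ e),
     a \in principal_ideal (p%:R : 'Z_(p ^ e)) -> iprng_period a b x0 = 1%N)
  /\ #|iprngs_of_period (principal_ideal (p%:R : 'Z_(p ^ e))) 1|
     = (p ^ (3 * e - 1))%N
  /\ (forall L : nat, L <> 1%N ->
        iprngs_of_period (principal_ideal (p%:R : 'Z_(p ^ e))) L = set0).
Proof.
have e0 : (0 < e)%N by apply: ltnW.
have q1 : (1 < p ^ e)%N by rewrite -(exp1n e) ltn_exp2r // prime_gt1.
have per1 (a b x0 : 'Z_(p ^ e)) :
    a \in principal_ideal (p%:R : 'Z_(p ^ e)) -> iprng_period a b x0 = 1%N.
  (* Nilpotency exponent [e]: the power [(p * y) ^+ e] has the factor [p ^ e], which is 0 here. *)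
  case/imsetP => y _ ->; apply: (@nilpotent_iprng_period _ _ _ e).
  by rewrite exprMn -natrX pchar_Zp // mul0r.
split=> //; split=> [|L /eqP L1]; last first.
  apply/setP => -[[a b] x0]; rewrite !inE /=; apply/negP => /andP[/per1 ->].
  by rewrite eq_sym (negbTE L1).
have -> : iprngs_of_period (principal_ideal (p%:R : 'Z_(p ^ e))) 1
    = setX (setX (principal_ideal p%:R) setT) setT.
  apply/setP => -[[a b] x0]; rewrite !inE /= !andbT.
  by have [/per1 ->|] := boolP (a \in _).
rewrite !cardsX cardsT card_ord card_principal_ideal_Zp ?dvdn_exp // Zp_cast //.
(* There are [p ^ e.-1] choices of [a], and [p ^ e] for each of [b] and [x0]. *)
rewrite -{1}(prednK e0) expnS mulKn ?prime_gt0 // -!expnD.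
by congr (_ ^ _)%N; rewrite -subn1 !addnBAC ?ltn_addr // !mulSn mul0n addn0 addnA.
Qed.
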